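(* Let $K$ be a field of characteristic zero with a discrete, non-archimedean valuation, let $f,g\in K[z]$ be polynomials with $1\le \deg(g)<\deg(f)$, let $C$ be the (polarized) correspondence $g(y)=f(x)$, and let $\alpha\in K$. Assume that (1) $C$ has good reduction; (2) $\deg(f)$ and $\deg(g)$ are units in the valuation ring of $K$; (3) $\gcd(\deg(f),\deg(g))=1$; and (4) $\alpha$ is not integral. Then $\operatorname{Gal}(\overline{K}/K)$ acts nearly transitively on $\check{\mathscr{P}}_{C,\alpha}$; that is, $\check{\mathscr{P}}_{C,\alpha}$ is a union of finitely many $\operatorname{Gal}(\overline{K}/K)$-orbits.
   Context: $\overline{K}$ is an algebraic closure of $K$. ''Integral'' means lying in the valuation ring of $K$. The correspondence $C: g(y)=f(x)$ is viewed as the directed graph with vertex set $\overline{K}$ and an edge from $x$ to $y$ if and only if $g(y)=f(x)$. It is called polarized if $\deg(g)<\deg(f)$. It has good reduction if the coefficients of $f$ and $g$ are integral and the leading coefficient of each is a unit of the valuation ring. $\check{\mathscr{P}}_{C,\alpha}$ is the set of backward paths from $\alpha$, i.e. the set of infinite sequences $\{\alpha_n\}_{n\ge 0}$ of elements of $\overline{K}$ with $\alpha_0=\alpha$ and $g(\alpha_n)=f(\alpha_{n+1})$ for all $n\ge 0$. The group $\operatorname{Gal}(\overline{K}/K)$ acts on it coordinatewise. A group $G$ acting on a set $X$ acts nearly transitively if $X$ is a union of finitely many $G$-orbits. *)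

(* Defs.v *)
From mathcomp Require Import all_boot all_order all_algebra.
From mathcomp Require Import boolp classical_sets cardinality.

Set Implicit Arguments.
Unset Strict Implicit.
Unset Printing Implicit Defensive.

Import Order.TTheory GRing.Theory Num.Theory.
Local Open Scope ring_scope.
Local Open Scope classical_set_scope.

(* Normalized (value group Z) discrete valuation. The value at 0, which should
   be +oo, is left unspecified: nothing below depends on it. *)
Record discrete_valuation (K : fieldType) := DiscreteValuation {
  dval :> K -> int;
  dvalM : forall x y, x != 0 -> y != 0 -> dval (x * y) = dval x + dval y;
  dvalD : forall x y, x != 0 -> y != 0 -> x + y != 0 ->
            Num.min (dval x) (dval y) <= dval (x + y);
  dval_surj : forall n : int, exists2 x, x != 0 & dval x = n
}.

Definition valuation_ring (K : fieldType) (v : discrete_valuation K) : {pred K} :=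
  [pred x : K | (x == 0) || (0 <= v x)].

Definition valuation_ring_unit (K : fieldType) (v : discrete_valuation K) :
    {pred K} :=
  [pred x : K | [&& x != 0, x \in valuation_ring v & x^-1 \in valuation_ring v]].

Definition deg (R : nzRingType) (p : {poly R}) : nat := (size p).-1.

Definition polarized (R : nzRingType) (f g : {poly R}) : Prop :=
  (deg g < deg f)%N.

Definition good_reduction (K : fieldType) (v : discrete_valuation K)
    (f g : {poly K}) : Prop :=
  [/\ f \is a polyOver (valuation_ring v),
      g \is a polyOver (valuation_ring v),
      lead_coef f \in valuation_ring_unit v &
      lead_coef g \in valuation_ring_unit v].

(* A closed field L is an algebraic closure of K along iota when moreover every
   element of L is algebraic over iota(K). *)
Definition algebraic_closure (K : fieldType) (L : closedFieldType)
    (iota : {rmorphism K -> L}) : Prop :=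
  forall z : L, algebraicOver iota z.

Definition corr_edge (K : fieldType) (L : closedFieldType)
    (iota : {rmorphism K -> L}) (f g : {poly K}) (x y : L) : Prop :=
  (map_poly iota g).[y] = (map_poly iota f).[x].

Definition backward_paths (K : fieldType) (L : closedFieldType)
    (iota : {rmorphism K -> L}) (f g : {poly K}) (alpha : K) : set (nat -> L) :=
  [set a | a 0%N = iota alpha /\
           forall n : nat, corr_edge iota f g (a n.+1) (a n)].

Record galois_aut (K : fieldType) (L : closedFieldType)
    (iota : {rmorphism K -> L}) := GaloisAut {
  galois_fun :> {rmorphism L -> L};
  galois_bij : bijective galois_fun;
  galois_fix : forall x : K, galois_fun (iota x) = iota x
}.

Definition galois_act (K : fieldType) (L : closedFieldType)
    (iota : {rmorphism K -> L}) (sigma : galois_aut iota) (a : nat -> L) :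
    nat -> L :=
  fun n => sigma (a n).

Definition act_orbit (G X : Type) (act : G -> X -> X) (x : X) : set X :=
  [set y | exists s : G, y = act s x].

Definition nearly_transitive (G X : Type) (act : G -> X -> X) (A : set X) : Prop :=
  exists2 S : set X, finite_set S & A = \bigcup_(x in S) act_orbit act x.

(* Main.v *)
(* Extend v to a valuation ring O of Kbar. Along a backward path, the value of
   alpha_n is v(alpha) (e/d)^n, where d = deg f and e = deg g are coprime. Two
   terms of a polynomial over K annihilating alpha_n must have the same value,
   so that the degree of alpha_n over K is at least d^n / |v(alpha)|, and so is
   the size of the Galois orbit of a path of length n. As there are at most d^n
   such paths, they fall into at most |v(alpha)| orbits, whatever n; by
   compactness of the Galois group the same bound holds for infinite paths. *)

Require Import Defs.
From HB Require Import structures.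
From mathcomp Require Import all_boot all_order all_algebra.
From mathcomp Require Import boolp classical_sets cardinality.
From mathcomp Require Import separable ring zify.

Set Implicit Arguments.
Unset Strict Implicit.
Unset Printing Implicit Defensive.

Import Order.TTheory GRing.Theory Num.Theory.
Local Open Scope ring_scope.

(** Only equality of values matters in [L], so no value group of [O] is constructed; integers appear
    only in K, where equal values mean equal [v]. Nor must [O] be stable under the Galois group: it
    only serves to bound degrees over K. Coprimality enters because equal values of the terms i < j
    give d^n (v(P_i) - v(P_j)) = (j - i) e^n v(alpha), from which e^n must be cancelled modulo d^n.
    Bounding the orbits level by level does not by itself produce representatives of infinite paths;
    instead |v(alpha)| + 1 paths are compared at once, and if no two are conjugate, a single finite
    level separates them all. The automorphisms and the extended valuation ring both come from one
    maximality statement on subrings. *)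

(** * Subrings and Zorn's lemma *)

Definition is_subring (R : nzRingType) (A : set R) : Prop :=
  [/\ A 1, forall x y, A x -> A y -> A (x - y)
    & forall x y, A x -> A y -> A (x * y)].

Section Subring.

Variables (R : nzRingType) (A : set R).
Hypothesis ringA : is_subring A.

Lemma subring1 : A 1. Proof. by case: ringA. Qed.
Lemma subringB x y : A x -> A y -> A (x - y). Proof. by case: ringA => _ + _; apply. Qed.
Lemma subringM x y : A x -> A y -> A (x * y). Proof. by case: ringA => _ _; apply. Qed.
Lemma subring0 : A 0. Proof. by rewrite -(subrr 1); apply: subringB; exact: subring1. Qed.
Lemma subringN x : A x -> A (- x).
Proof. by rewrite -sub0r; apply: subringB; exact: subring0. Qed.
Lemma subringD x y : A x -> A y -> A (x + y).
Proof. by move=> Ax Ay; rewrite -(opprK y); apply: subringB => //; exact: subringN. Qed.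
Lemma subringX x n : A x -> A (x ^+ n).
Proof.
by move=> Ax; elim: n => [|n IH]; [exact: subring1 | rewrite exprS; exact: subringM].
Qed.
Lemma subring_sum (I : Type) (r : seq I) (P : pred I) (F : I -> R) :
  (forall i, P i -> A (F i)) -> A (\sum_(i <- r | P i) F i).
Proof. by move=> AF; apply: big_ind => //; [exact: subring0 | exact: subringD]. Qed.

Lemma subring_poly (p q : {poly R}) c k :
  (forall i, A p`_i) -> (forall i, A q`_i) -> A c ->
  forall i, A (p - c *: 'X^k * q)`_i.
Proof.
move=> Ap Aq Ac i; rewrite coefB -scalerAl coefZ coefXnM.
apply: subringB => //; apply: subringM => //.
by case: ifP => // _; exact: subring0.
Qed.

End Subring.

Lemma subring_adjoin (R : comNzRingType) (A : set R) (x : R) :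
  is_subring A ->
  is_subring [set z | exists2 q : {poly R}, (forall i, A q`_i) & z = q.[x]]%classic.
Proof.
move=> ringA; split.
- exists 1; last by rewrite hornerC.
  move=> i; rewrite coef1; case: eqP => _; [exact: subring1 | exact: subring0].
- move=> _ _ [p Ap ->] [q Aq ->]; exists (p - q); last by rewrite hornerD hornerN.
  by move=> i; rewrite coefB; exact: subringB.
- move=> _ _ [p Ap ->] [q Aq ->]; exists (p * q); last by rewrite hornerM.
  by move=> i; rewrite coefM; apply: subring_sum => // j _; exact: subringM.
Qed.

(** By maximality, adjoining any x outside [A] must meet [B]. Used twice: in a field with [B] =
    {p^-1}, where [A] becomes a valuation ring, and in [L * L] with [B] the pairs (0, y), y nonzero,
    where [A] becomes the graph of an automorphism. *)
Lemma maximal_subring (R : comNzRingType) (A0 B : set R) :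
  is_subring A0 -> (forall x, A0 x -> ~ B x) ->
  exists A : set R, [/\ is_subring A, (forall x, A0 x -> A x),
    (forall x, A x -> ~ B x) &
    forall x, ~ A x -> exists q : {poly R}, (forall i, A q`_i) /\ B q.[x]].
Proof.
move=> ringA0 A0B.
(* The empty set is allowed because Zorn_bigcup also takes the union of the empty chain. *)
pose good (A : set R) := [/\ is_subring A, (forall x, A0 x -> A x) &
  forall x, A x -> ~ B x].
have good0 : good A0 by [].
have [|A [PA maxA]] := @Zorn_bigcup R (fun A => A = set0 \/ good A).
- move=> F FP totF.
  have [[A FA neA]|Fe] := pselect (exists2 A, F A & A <> set0); last first.
    left; apply/seteqP; split=> // x [A FA Ax].
    by apply: Fe; exists A => // A0e; rewrite A0e in Ax.
  right.
  have gF C : F C -> C <> set0 -> good C by move=> /FP[].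
  have two x y C D : F C -> F D -> C x -> D y ->
      exists2 E, F E /\ good E & E x /\ E y.
    move=> FC FD Cx Dy.
    have gC : good C by apply: gF => // Ce; rewrite Ce in Cx.
    have gD : good D by apply: gF => // De; rewrite De in Dy.
    case: (totF C D FC FD) => sub; first by exists D => //; split=> //; apply: sub.
    by exists C => //; split=> //; apply: sub.
  have [ringA A0A _] := gF _ FA neA.
  split.
  + split.
    * by exists A => //; exact: subring1.
    * move=> x y [C FC Cx] [D FD Dy].
      have [E [FE [ringE _ _]] [Ex Ey]] := two _ _ _ _ FC FD Cx Dy.
      by exists E => //; exact: subringB.
    * move=> x y [C FC Cx] [D FD Dy].
      have [E [FE [ringE _ _]] [Ex Ey]] := two _ _ _ _ FC FD Cx Dy.
      by exists E => //; exact: subringM.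
  + by move=> x A0x; exists A => //; exact: A0A.
  + move=> x [C FC Cx].
    have [|_ _] := gF C FC; first by move=> Ce; rewrite Ce in Cx.
    exact.
case: PA => [Ae|gA].
  exfalso; apply: (maxA A0); last by right.
  rewrite Ae; split; first by move=> x [].
  by move=> /(_ 1 (subring1 ringA0)).
have [ringA A0A AB] := gA.
exists A; split=> // x nAx; apply: contrapT => noq.
have ringAx := subring_adjoin x ringA.
apply: (maxA _ _ (or_intror (And3 ringAx _ _))).
- split.
    move=> y Ay; exists y%:P; last by rewrite hornerC.
    by move=> i; rewrite coefC; case: eqP => // _; exact: subring0.
  move=> /(_ x); apply: contra_not nAx; apply.
  exists 'X; last by rewrite hornerX.
  by move=> i; rewrite coefX; case: eqP => // _; [exact: subring1|exact: subring0].
- move=> y /A0A Ay; exists y%:P; last by rewrite hornerC.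
  by move=> i; rewrite coefC; case: eqP => // _; exact: subring0.
- by move=> _ [q Aq ->] Bq; apply: noq; exists q.
Qed.

(** * Valuation rings and Chevalley's extension theorem *)

Record is_valuation_ring (L : fieldType) (O : set L) : Prop := {
  vring_subring : is_subring O;
  vring_total : forall x, x != 0 -> O x \/ O x^-1 }.

(** Maximality puts p in the Jacobson radical of [A]. If neither x nor x^-1 were in [A], then p^-1
    would be a polynomial over [A] in each of them, and two such expressions of equal length shorten
    each other until p^-1 lies in [A]. *)
Lemma valuation_ring_extension (L : fieldType) (A0 : set L) (p : L) :
  is_subring A0 -> p != 0 -> A0 p -> ~ A0 p^-1 ->
  exists O : set L, [/\ is_valuation_ring O, (forall x, A0 x -> O x) & ~ O p^-1].
Proof.
move=> ringA0 p0 A0p nA0p.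
have [|A [ringA A0A AB maxA]] := @maximal_subring L A0 [set p^-1]%classic ringA0.
  by move=> x Ax xp; apply: nA0p; rewrite -xp.
have nAp : ~ A p^-1 by move/AB; apply.
exists A; split=> //; split=> // x x0.
have [Ax|nAx] := pselect (A x); first by left.
have [Ax|nAx'] := pselect (A x^-1); first by right.
exfalso.
(* That is, p^-1 lies in A + A y + ... + A y^n. *)
pose E y n := exists2 a : nat -> L, (forall i, A (a i)) &
  p * \sum_(i < n.+1) a i * y ^+ i = 1.
have E0 y : E y 0%N -> False.
  case=> a Aa; rewrite big_ord1 expr0 mulr1 => pa; apply: nAp.
  suff -> : p^-1 = a 0%N by [].
  by rewrite -[RHS](mulKf p0) pa mulr1.
have ES y n : E y n -> E y n.+1.
  case=> a Aa e; exists (fun i => if (i <= n)%N then a i else 0).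
    by move=> i; case: ifP => // _; exact: subring0.
  rewrite big_ord_recr /= ltnn mul0r addr0 -[RHS]e; congr (_ * _).
  by apply: eq_bigr => i _; rewrite -ltnS ltn_ord.
have Ex y : ~ A y -> exists n, E y n.
  move=> /maxA[q [Aq qp]]; exists (size q); exists (fun i => q`_i) => //.
  rewrite big_ord_recr /= nth_default // mul0r addr0 -horner_coef qp.
  by rewrite divff.
have Einv c : A c -> A (1 - p * c)^-1.
  move=> Ac; apply: contrapT => /maxA[q [Aq qp]].
  have d0 : 1 - p * c != 0.
    apply/eqP => /eqP; rewrite subr_eq0 => /eqP e; apply: nAp.
    suff -> : p^-1 = c by [].
    by rewrite -[RHS](mulKf p0) -e mulr1.
  apply: nAp.
  (* Multiply q.[1 / d] = 1 / p by a power of d, which is 1 modulo p A. *)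
  set d := 1 - p * c in d0 qp *; have Ad : A d.
    by apply: subringB => //; [exact: subring1|apply: subringM => //; exact: A0A].
  have [b Ab db] : exists2 b, A b & d ^+ size q = 1 - p * b.
    elim: (size q) => [|n [b Ab IH]]; first by exists 0; [exact: subring0|rewrite mulr0 subr0].
    exists (b + c - p * b * c).
      by apply: subringB => //; [exact: subringD|do 2?apply: subringM => //; exact: A0A].
    by rewrite exprS IH /d; ring.
  have -> : p^-1 = b + \sum_(i < size q) q`_i * d ^+ (size q - i).
    apply: (mulfI p0); rewrite divff // mulrDr.
    have -> : \sum_(i < size q) q`_i * d ^+ (size q - i) = d ^+ size q * q.[d^-1].
      rewrite horner_coef mulr_sumr; apply: eq_bigr => i _.
      rewrite mulrCA exprVn expfB_cond //.
      by rewrite (negbTE d0) add0n ltnW.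
    by rewrite qp mulrCA divff // mulr1 db addrC subrK.
  apply: subringD => //; apply: subring_sum => // i _.
  by apply: subringM => //; exact: subringX.
(* The relation for y^-1, multiplied by y^(n+1), has leading coefficient 1 - p b_0, a unit of [A];
   it expresses y^(n+1) by lower powers, which removes the top term of the relation for y. *)
have desc y n : y != 0 -> E y n.+1 -> E y^-1 n.+1 -> E y n.
  move=> y0 [a Aa ea] [b Ab eb].
  pose c := (1 - p * b 0%N)^-1; have Ac : A c by exact: Einv.
  have d0 : 1 - p * b 0%N != 0.
    apply/eqP => /eqP; rewrite subr_eq0 => /eqP e; apply: nAp.
    suff -> : p^-1 = b 0%N by [].
    by rewrite -[RHS](mulKf p0) -e mulr1.
  have yn : y ^+ n.+1 = c * (p * \sum_(i < n.+1) b (n.+1 - i)%N * y ^+ i).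
    apply: (canRL (mulKf d0)); rewrite -[X in X - _]eb.
    rewrite big_ord_recl expr0 mulr1 mulrDr addrC addKr -mulrA; congr (_ * _).
    rewrite mulr_suml (reindex_inj rev_ord_inj) /=; apply: eq_bigr => i _.
    rewrite /bump /= add1n -mulrA exprVn subSS subSn -1?ltnS //; congr (b _ * _).
    rewrite mulrC -expfB_cond; last by rewrite (negbTE y0) ltnS leq_subr.
    by rewrite subSS subKn // -ltnS.
  exists (fun i => a i + a n.+1 * (c * p) * b (n.+1 - i)%N).
    move=> i; apply: subringD => //; apply: subringM => //.
    by do 2?apply: subringM => //; exact: A0A.
  rewrite -[RHS]ea; congr (_ * _); rewrite [RHS]big_ord_recr /= yn.
  rewrite !mulrA mulr_sumr -big_split /=; apply: eq_bigr => i _.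
  by rewrite mulrDl !mulrA.
have [n [En En']] : exists n, E x n /\ E x^-1 n.
  have [n En] := Ex _ nAx; have [m Em] := Ex _ nAx'.
  exists (n + m)%N; split; first by elim: m {Em} => [|m IH]; rewrite ?addn0 ?addnS //; apply: ES.
  by elim: n {En} => [|n IH] //; rewrite addSn; apply: ES.
elim: n En En' => [|n IH] En En'; first exact: E0 En.
by apply: IH; apply: desc; rewrite ?invr_eq0 ?invrK.
Qed.

(** * Comparison of values relative to a valuation ring *)

Section ValuationRing.

Variables (L : fieldType) (O : set L).
Hypothesis valO : is_valuation_ring O.
Let ringO : is_subring O := vring_subring valO.

(** The quotient is a unit of [O]. The nonvanishing conditions are essential: division by 0 gives 0,
    so the two memberships alone would relate 0 to everything. *)
Definition same_value (x y : L) : Prop :=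
  [/\ x != 0, y != 0, O (x / y) & O (y / x)].

Lemma same_value_refl x : x != 0 -> same_value x x.
Proof. by move=> x0; split=> //; rewrite divff //; exact: subring1. Qed.

Lemma same_value_sym x y : same_value x y -> same_value y x.
Proof. by case. Qed.

Lemma same_value_trans y x z : same_value x y -> same_value y z -> same_value x z.
Proof.
move=> [x0 y0 Oxy Oyx] [_ z0 Oyz Ozy]; split=> //.
- have -> : x / z = x / y * (y / z) by rewrite mulrA divfK.
  exact: subringM.
- have -> : z / x = z / y * (y / x) by rewrite mulrA divfK.
  exact: subringM.
Qed.

Lemma same_valueM x y x' y' :
  same_value x y -> same_value x' y' -> same_value (x * x') (y * y').
Proof.
move=> [x0 y0 Oxy Oyx] [x0' y0' Oxy' Oyx'].
by split; rewrite ?mulf_neq0 // -mulf_div; exact: subringM.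
Qed.

Lemma same_valueX n x y : same_value x y -> same_value (x ^+ n) (y ^+ n).
Proof.
move=> xy; elim: n => [|n IH]; last by rewrite !exprS; exact: same_valueM.
exact/same_value_refl/oner_neq0.
Qed.

Lemma same_value_mem x y : same_value x y -> O x -> O y.
Proof. by move=> [x0 _ _ Oyx] Ox; rewrite -(divfK x0 y); exact: subringM. Qed.

Lemma mem_exp n x : (0 < n)%N -> O (x ^+ n) -> O x.
Proof.
case: n => // n _; have [->|x0] := eqVneq x 0; first by move=> _; exact: subring0.
have [//|Ox' Oxn] := vring_total valO x0.
rewrite -[x](mulKf (expf_neq0 n x0)) -exprVn -exprSr.
by apply: subringM => //; exact: subringX.
Qed.

(** The hypotheses say that y has strictly larger value than x. Then x / (x + y) = 1 - y / (x + y)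
    is in [O], for otherwise totality puts (x + y) / y, hence x / y, in [O]. *)
Lemma same_value_addr x y : x != 0 -> O (y / x) -> ~ O (x / y) -> same_value (x + y) x.
Proof.
move=> x0 Oyx nOxy.
have y0 : y != 0.
  by apply/eqP => y0; apply: nOxy; rewrite y0 invr0 mulr0; exact: subring0.
have xy0 : x + y != 0.
  apply/eqP => xy0; apply: nOxy.
  rewrite (_ : x = - y) ?mulNr ?divff //; first by apply: subringN => //; exact: subring1.
  by apply/eqP; rewrite -addr_eq0 xy0.
have Oxyx : O ((x + y) / x) by rewrite mulrDl divff //; apply: subringD => //; exact: subring1.
split=> //.
have [|Oz|Oz] := vring_total valO (_ : y / (x + y) != 0).
- by rewrite mulf_neq0 ?invr_eq0.
- rewrite -[X in X / _](addrK y) mulrBl divff //.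
  by apply: subringB => //; exact: subring1.
- exfalso; apply: nOxy; rewrite -[X in X / _](addrK y) mulrBl divff //.
  by apply: subringB => //; [rewrite -invf_div|exact: subring1].
Qed.

Lemma same_value_add x y : x != 0 -> y != 0 -> ~ same_value x y ->
  same_value (x + y) x \/ same_value (x + y) y.
Proof.
move=> x0 y0 nxy.
have [|Oz|Oz] := vring_total valO (_ : x / y != 0).
- by rewrite mulf_neq0 ?invr_eq0.
- by right; rewrite addrC; apply: same_value_addr => // Oz'; apply: nxy.
- rewrite invf_div in Oz.
  by left; apply: same_value_addr => // Oz'; apply: nxy.
Qed.

(** By induction the tail has the value of one of its terms, which differs from that of the head. It
    is used in contrapositive form: a vanishing sum has two terms of equal value. *)
Lemma same_value_sum (I : eqType) (r : seq I) (F : I -> L) :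
  uniq r -> r <> [::] -> (forall i, i \in r -> F i != 0) ->
  (forall i j, i \in r -> j \in r -> i != j -> ~ same_value (F i) (F j)) ->
  exists2 i, i \in r & same_value (\sum_(i <- r) F i) (F i).
Proof.
elim: r => // i [|j r] IH.
  move=> _ _ F0 _; exists i; first by rewrite inE.
  by rewrite big_seq1; apply: same_value_refl; apply: F0; rewrite inE.
rewrite cons_uniq => /andP[ir ur] _ F0 dist.
have [//||a b ar br|k kr Sk] := IH ur.
- by move=> a ar; apply: F0; rewrite inE ar orbT.
- by apply: dist; rewrite inE ?ar ?br orbT.
have kir : k \in i :: j :: r by rewrite inE kr orbT.
have iir : i \in i :: j :: r by rewrite inE eqxx.
rewrite big_cons.
have [||iS|iS|kS] := @same_value_add (F i) (\sum_(i <- j :: r) F i).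
- exact: F0.
- by case: Sk.
- apply: (dist i k) => //; first by apply: contraNneq ir => ->.
  exact: same_value_trans iS Sk.
- by exists i.
- by exists k => //; exact: same_value_trans kS Sk.
Qed.

(** At a non-integral point the leading term has the least value: the lower terms are x^k times an
    integral polynomial in x^-1, while the leading term carries one more factor x. *)
Lemma same_value_horner (h : {poly L}) x :
  (forall i, O h`_i) -> h != 0 -> O (lead_coef h)^-1 -> ~ O x ->
  same_value h.[x] (x ^+ (size h).-1).
Proof.
move=> Oh h0 Olc nOx.
have x0 : x != 0 by apply/eqP => xe; apply: nOx; rewrite xe; exact: subring0.
have Ox' : O x^-1 by case: (vring_total valO x0).
have lc0 : lead_coef h != 0 by rewrite lead_coef_eq0.
rewrite lead_coefE in lc0 Olc; rewrite horner_coef.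
have -> : size h = (size h).-1.+1 by rewrite -polySpred.
case: (size h).-1 lc0 Olc => [|k] lc0 Olc /=.
  rewrite big_ord1 expr0 mulr1; split; rewrite ?oner_neq0 ?invr1 ?mulr1 ?mul1r //.
rewrite big_ord_recr /= addrC.
have lcx : same_value (h`_k.+1 * x ^+ k.+1) (x ^+ k.+1).
  rewrite -[X in same_value _ X]mul1r; apply: same_valueM.
    by split; rewrite ?oner_neq0 ?invr1 ?mulr1 ?mul1r.
  exact/same_value_refl/expf_neq0.
set S := \sum_(i < _) _.
have [s Os Ss] : exists2 s, O s & S = x ^+ k * s.
  exists (\sum_(i < k.+1) h`_i * x^-1 ^+ (k - i)).
    by apply: subring_sum => // i _; apply: subringM => //; exact: subringX.
  rewrite mulr_sumr; apply: eq_bigr => i _; rewrite mulrCA; congr (_ * _).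
  rewrite exprVn -expfB_cond; last by rewrite (negbTE x0) leq_subr.
  by rewrite subKn // -ltnS.
have [se|s0] := eqVneq s 0; first by rewrite Ss se mulr0 addr0.
have xk0 : x ^+ k != 0 by exact: expf_neq0.
apply: same_value_trans lcx; apply: same_value_addr.
- by rewrite mulf_neq0 ?expf_neq0.
- rewrite Ss exprSr (_ : _ / _ = s * (h`_k.+1)^-1 * x^-1).
    by do 2?apply: subringM => //.
  by field; rewrite x0 lc0 xk0.
- rewrite Ss exprSr => Oz; apply: nOx.
  rewrite (_ : x = (h`_k.+1)^-1 * s * (h`_k.+1 * (x ^+ k * x) / (x ^+ k * s))).
    by do 2?apply: subringM => //.
  by field; rewrite s0 lc0 xk0.
Qed.

(** An integral y would make f(y) = g(x) integral, hence a power of x, hence x. So the leading terms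
    dominate on both sides of the equation. *)
Lemma same_value_edge (f g : {poly L}) x y :
  (forall i, O f`_i) -> f != 0 -> O (lead_coef f)^-1 ->
  (forall i, O g`_i) -> (1 < size g)%N -> O (lead_coef g)^-1 ->
  ~ O x -> g.[x] = f.[y] ->
  ~ O y /\ same_value (y ^+ (size f).-1) (x ^+ (size g).-1).
Proof.
move=> Of f0 lcf Og sg lcg nOx gf.
have gx : same_value g.[x] (x ^+ (size g).-1).
  by apply: same_value_horner => //; rewrite -size_poly_gt0 ltnW.
have nOy : ~ O y.
  move=> Oy; apply: nOx; apply: (@mem_exp (size g).-1); first by rewrite -ltnS prednK // ltnW.
  apply: same_value_mem gx _; rewrite gf horner_coef.
  by apply: subring_sum => // i _; apply: subringM => //; exact: subringX.
split=> //; apply: same_value_trans gx; rewrite gf.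
exact/same_value_sym/same_value_horner.
Qed.

End ValuationRing.

(** * The discrete valuation of K, its extension to [L], and degrees over K *)

Section DiscreteValuation.

Variables (K : fieldType) (v : discrete_valuation K).

Lemma dval1 : v 1 = 0.
Proof.
have := dvalM v (oner_neq0 K) (oner_neq0 K).
by rewrite mulr1 => /eqP; rewrite -subr_eq0 opprD addNKr oppr_eq0 => /eqP.
Qed.

Lemma dvalV x : x != 0 -> v x^-1 = - v x.
Proof.
move=> x0; apply/eqP; rewrite -addr_eq0 addrC -dvalM ?invr_eq0 //.
by rewrite divff // dval1.
Qed.

Lemma dvalX x n : x != 0 -> v (x ^+ n) = v x *+ n.
Proof.
move=> x0; elim: n => [|n IH]; first exact: dval1.
by rewrite exprS dvalM ?expf_neq0 // IH mulrS.
Qed.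

Lemma dvalN1 : v (-1) = 0.
Proof.
have N10 : -1 != 0 :> K by rewrite oppr_eq0 oner_neq0.
have := dvalX 2 N10; rewrite sqrrN expr1n dval1 => /esym/eqP.
by rewrite mulrn_eq0 => /eqP.
Qed.

Lemma valuation_ringP x : x != 0 -> (x \in valuation_ring v) = (0 <= v x).
Proof. by rewrite inE => /negbTE ->. Qed.

Lemma valuation_ring_subring : is_subring [set x | x \in valuation_ring v]%classic.
Proof.
split=> /=.
- by rewrite valuation_ringP ?oner_neq0 // dval1.
- move=> x y Ox Oy.
  have [->|y0] := eqVneq y 0; first by rewrite subr0.
  have [->|xy0] := eqVneq (x - y) 0; first by rewrite inE eqxx.
  have N10 : -1 != 0 :> K by rewrite oppr_eq0 oner_neq0.
  have y0' : - y != 0 by rewrite oppr_eq0.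
  have vy : 0 <= v (- y) by rewrite -mulN1r dvalM // dvalN1 add0r -valuation_ringP.
  have [xe|x0] := eqVneq x 0; first by rewrite xe sub0r valuation_ringP.
  rewrite valuation_ringP //; apply: le_trans (dvalD v x0 y0' xy0).
  by rewrite le_min vy -valuation_ringP // Ox.
- move=> x y Ox Oy.
  have [->|x0] := eqVneq x 0; first by rewrite mul0r inE eqxx.
  have [->|y0] := eqVneq y 0; first by rewrite mulr0 inE eqxx.
  by rewrite valuation_ringP ?mulf_neq0 // dvalM // addr_ge0 // -valuation_ringP.
Qed.

End DiscreteValuation.

(** Excluding the inverse of one uniformizer p keeps all non-integral elements of K out of [O]: if
    v(x) <= -1, then p^-1 = x (x^-1 p^-1) with an integral second factor. *)
Lemma valuation_ring_over (K : fieldType) (v : discrete_valuation K)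
    (L : fieldType) (iota : {rmorphism K -> L}) :
  exists O : set L, is_valuation_ring O /\
    forall x, O (iota x) <-> x \in valuation_ring v.
Proof.
have [p p0 vp] := dval_surj v 1.
pose A0 : set L := [set y | exists2 x, x \in valuation_ring v & y = iota x]%classic.
have [rv1 rvB rvM] := valuation_ring_subring v.
have ringA0 : is_subring A0.
  split.
  - by exists 1; rewrite ?rmorph1.
  - by move=> _ _ [x Ox ->] [y Oy ->]; exists (x - y); rewrite ?rmorphB //; exact: rvB.
  - by move=> _ _ [x Ox ->] [y Oy ->]; exists (x * y); rewrite ?rmorphM //; exact: rvM.
have [|||O [valO A0O nOp]] := @valuation_ring_extension L A0 (iota p) ringA0.
- by rewrite fmorph_eq0.
- by exists p; rewrite // valuation_ringP // vp.
- move=> [x Ox e]; have : p^-1 \in valuation_ring v.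
    by rewrite (_ : p^-1 = x) //; apply: (fmorph_inj iota); rewrite fmorphV.
  by rewrite valuation_ringP ?invr_eq0 // dvalV // vp.
exists O; split=> // x; split=> [Ox|]; last by move=> vx; apply: A0O; exists x.
apply: contrapT => /negP nvx; apply: nOp.
have x0 : x != 0 by apply: contraNneq nvx => ->; rewrite inE eqxx.
rewrite valuation_ringP // -ltNge in nvx.
rewrite -fmorphV -(mulVKf x0 p^-1) rmorphM; apply: subringM => //.
  exact: vring_subring.
apply: A0O; exists (x^-1 * p^-1) => //.
rewrite valuation_ringP ?mulf_neq0 ?invr_eq0 // dvalM ?invr_eq0 // !dvalV // vp.
by rewrite subr_ge0 lerNr -ltzD1 addNr.
Qed.

(* Two terms of P, of indices i < j, have the same value at t, hence q divides
   (j - i) e v(a). *)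
Lemma annihilator_size (K : fieldType) (v : discrete_valuation K)
    (L : fieldType) (iota : {rmorphism K -> L}) (O : set L)
    (valO : is_valuation_ring O)
    (Ov : forall x, O (iota x) <-> x \in valuation_ring v)
    (P : {poly K}) (t : L) (a : K) (q e : nat) :
  P != 0 -> root (map_poly iota P) t -> a != 0 -> v a != 0 -> (0 < q)%N ->
  coprime q e -> same_value O (t ^+ q) (iota a ^+ e) ->
  (q <= (size P).-1 * `|v a|)%N.
Proof.
move=> P0 Pt a0 va0 q0 cqe te.
have same_dval x y : same_value O (iota x) (iota y) -> v x = v y.
  rewrite /same_value !fmorph_eq0 -!fmorph_div => -[x0 y0 /Ov + /Ov].
  rewrite !valuation_ringP ?mulf_neq0 ?invr_eq0 // !dvalM ?invr_eq0 // !dvalV //.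
  by rewrite !subr_ge0 => yx xy; apply/eqP; rewrite eq_le yx xy.
have t0 : t != 0.
  by case: te => + _ _ _; rewrite expf_eq0 q0.
pose r := [seq i <- seq.iota 0 (size P) | P`_i != 0].
pose F i := iota P`_i * t ^+ i.
have sumF : \sum_(i <- r) F i = 0.
  have := Pt; rewrite /root horner_coef size_map_poly => /eqP Pt0.
  rewrite -[RHS]Pt0 big_filter big_mkcond.
  rewrite -(big_mkord xpredT (fun i => (map_poly iota P)`_i * t ^+ i)).
  rewrite /index_iota subn0; apply: eq_bigr => i _; rewrite coef_map /=.
  by case: eqP => //= ->; rewrite rmorph0 mul0r.
have F0 i : i \in r -> F i != 0.
  by rewrite mem_filter => /andP[Pi _]; rewrite mulf_neq0 ?expf_neq0 // fmorph_eq0.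
have [i [j [ir jr ij Fij]]] : exists i j, [/\ i \in r, j \in r, (i < j)%N &
    same_value O (F i) (F j)].
  apply: contrapT => noij.
  have [||||i ir [Fi0 _ _ _]] := @same_value_sum L O valO _ r F.
  - by rewrite filter_uniq ?iota_uniq.
  - have : (size P).-1 \in r.
      rewrite mem_filter -lead_coefE lead_coef_eq0 P0 mem_iota /= add0n.
      by rewrite ltn_predL size_poly_gt0.
    by case: (r).
  - exact: F0.
  - move=> i j ir jr; rewrite neq_ltn => /orP[ij|ji] Fij; apply: noij.
      by exists i, j.
    by exists j, i; split=> //; exact: same_value_sym.
  - by rewrite sumF eqxx in Fi0.
have Pk0 k : k \in r -> P`_k != 0 by rewrite mem_filter => /andP[].
have jP : (j < size P)%N by move: jr; rewrite mem_filter mem_iota => /andP[_ /andP[]].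
(* Divide both terms by t^i and raise to the power q: t^(q (j - i)) can then be traded for a^(e (j -
   i)), which leaves a comparison between elements of K. *)
have key : v (P`_i) *+ q = v (P`_j) *+ q + v a *+ (e * (j - i)).
  have aj0 : a ^+ (e * (j - i)) != 0 by exact: expf_neq0.
  rewrite -!dvalX ?Pk0 // -dvalM ?expf_neq0 ?Pk0 //; apply: same_dval.
  have -> : iota (P`_i ^+ q) = (F i / t ^+ i) ^+ q.
    by rewrite rmorphXn /F mulfK ?expf_neq0.
  rewrite rmorphM !rmorphXn.
  apply: (@same_value_trans L O valO ((F j / t ^+ i) ^+ q)).
    apply: same_valueX => //; apply: same_valueM => //.
    by apply: same_value_refl; rewrite // invr_eq0 expf_neq0.
  have -> : F j / t ^+ i = iota P`_j * t ^+ (j - i).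
    by rewrite /F -mulrA expfB.
  rewrite exprMn; apply: same_valueM => //.
    by apply: same_value_refl; rewrite // expf_neq0 // fmorph_eq0 Pk0.
  by rewrite -exprM mulnC !exprM; exact: same_valueX.
have dvd : (q %| (j - i) * `|v a|)%N.
  rewrite -(Gauss_dvdr _ cqe) mulnA.
  have : v a *+ (e * (j - i)) = (v P`_i - v P`_j) *+ q.
    by rewrite mulrnBl key addrC addKr.
  have abszMn (z : int) n : absz (z *+ n) = (`|z| * n)%N by rewrite -mulr_natr abszM natz.
  move=> /(congr1 absz); rewrite !abszMn mulnC => ->.
  exact: dvdn_mull.
apply: (leq_trans (dvdn_leq _ dvd)).
  by rewrite muln_gt0 subn_gt0 ij absz_gt0.
rewrite leq_mul2r; apply/orP; right.
by rewrite (leq_trans (leq_subr _ _)) // -ltnS (leq_trans jP) // leqSpred.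
Qed.

(** * Minimal polynomials along an embedding *)

Lemma minimal_annihilator (K : fieldType) (L : fieldType)
    (iota : {rmorphism K -> L}) (t : L) :
  algebraicOver iota t ->
  exists P : {poly K}, [/\ P != 0, root (map_poly iota P) t &
    forall q, root (map_poly iota q) t -> P %| q].
Proof.
move=> [p p0 pt].
pose ann n := `[< exists q : {poly K}, [/\ q != 0, root (map_poly iota q) t & size q = n] >].
have exn : exists n, ann n by exists (size p); apply/asboolP; exists p.
case: (ex_minnP exn) => n /asboolP[P [P0 Pt <-]] minP.
exists P; split=> // q qt; rewrite /dvdp; apply: contraT => r0.
have : ann (size (q %% P)).
  apply/asboolP; exists (q %% P); split=> //.
  move: qt; rewrite {1}(divp_eq q P) rmorphD rmorphM /root hornerD hornerM.
  by rewrite (rootP Pt) mulr0 add0r.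
by move=> /minP; rewrite leqNgt ltn_modp P0.
Qed.

(** Write P = H G with G = gcd(P, P'); t is a root of [H] or of [G]. In the first case P divides [H]
    and [G] is constant; in the second P divides P', which is nonzero in characteristic zero and of
    smaller degree. *)
Lemma minimal_separable (K : fieldType) (L : fieldType)
    (iota : {rmorphism K -> L}) (t : L) (P : {poly K}) :
  [pchar K] =i pred0 -> P != 0 -> root (map_poly iota P) t ->
  (forall q, root (map_poly iota q) t -> P %| q) -> separable_poly P.
Proof.
move=> charK P0 Pt minP.
have sP : (1 < size P)%N.
  rewrite ltnNge; apply/negP => /size1_polyC Pc; move: Pt P0.
  by rewrite Pc map_polyC rootC fmorph_eq0 polyC_eq0 => ->.
have dP0 : P^`() != 0.
  apply/eqP => /polyP/(_ (size P).-2); rewrite coef_deriv coef0 prednK -?lead_coefE; last first.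
    by rewrite -ltnS prednK // ltnW.
  move=> /eqP; rewrite -mulr_natr mulf_eq0 lead_coef_eq0 (negbTE P0) /=.
  by rewrite (iffLR (pcharf0P K) charK) -leqn0 leqNgt -ltnS prednK ?sP // ltnW.
rewrite unlock /coprimep.
set G := gcdp _ _; have /dvdpP[H PGH] : G %| P by exact: dvdp_gcdl.
have : root (map_poly iota H) t || root (map_poly iota G) t.
  by rewrite -rootM -rmorphM -PGH.
have H0 : H != 0 by apply: contraNneq P0 => H0; rewrite PGH H0 mul0r.
have G0 : G != 0 by rewrite gcdp_eq0 negb_and P0.
case/orP => /minP /dvdp_leq.
  move=> /(_ H0); rewrite PGH size_mul // -ltnS prednK; last first.
    by rewrite addn_gt0 size_poly_gt0 H0.
  rewrite -addn1 leq_add2l => sG.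
  by rewrite eqn_leq sG size_poly_gt0.
move=> /(_ G0) PG; have : (size P <= size P^`())%N.
  by apply: leq_trans PG _; apply: dvdp_leq => //; exact: dvdp_gcdr.
by rewrite leqNgt lt_size_deriv.
Qed.

(** * Automorphisms of the algebraic closure over K *)

Section GaloisExtension.

Variables (K : fieldType) (L : closedFieldType) (iota : {rmorphism K -> L}).
Hypothesis closureK : algebraic_closure iota.

(** The minimal polynomial of a nonzero element is prime to X, and a Bezout relation evaluated at a
    yields the inverse. This keeps inverses inside partial homomorphisms. *)
Lemma inv_polynomial (a : L) : a != 0 ->
  exists q : {poly K}, a * (map_poly iota q).[a] = 1.
Proof.
move=> a0; have [P [P0 Pa minP]] := minimal_annihilator (closureK a).
have P00 : ~~ root P 0.
  apply/negP; rewrite -[0]oppr0 => /factor_theorem[r]; rewrite oppr0 subr0 => Pr.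
  have r0 : r != 0 by apply: contraNneq P0 => r0; rewrite Pr r0 mul0r.
  have : root (map_poly iota r) a.
    by move: Pa; rewrite Pr rmorphM rootM /= map_polyX rootX (negbTE a0) orbF.
  by move=> /minP /dvdp_leq -/(_ r0); rewrite Pr size_mulX // ltnn.
have : coprimep P 'X by rewrite coprimepX.
move=> /Bezout_eq1_coprimepP[[u w] /= uw]; exists w.
have := congr1 (fun p => (map_poly iota p).[a]) uw.
rewrite rmorphD !rmorphM /= map_polyX rmorph1 hornerD !hornerM hornerX hornerC.
by rewrite (rootP Pa) mulr0 add0r mulrC.
Qed.

(* A set of pairs which is a subring and contains (0, y) only for y = 0 is the
   graph of a homomorphism between subrings of L. *)
Definition partial_hom (A : set (L * L)) : Prop :=
  [/\ is_subring A, forall x, A (iota x, iota x) & forall y, A (0, y) -> y = 0].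

Lemma partial_hom_poly (A : set (L * L)) (p : {poly K}) z :
  partial_hom A -> A z -> A ((map_poly iota p).[z.1], (map_poly iota p).[z.2]).
Proof.
move=> [ringA AK _] Az; elim/poly_ind: p => [|p c IH].
  by rewrite rmorph0 !horner0; exact: (subring0 ringA).
rewrite rmorphD rmorphM /= map_polyX map_polyC !hornerMXaddC.
have := subringD ringA (subringM ringA IH Az) (AK c).
by [].
Qed.

Lemma partial_hom_unit (A : set (L * L)) z :
  partial_hom A -> A z -> z.1 != 0 -> exists2 w, A w & w * z = 1.
Proof.
move=> homA Az z0; have [q qz] := inv_polynomial z0.
have Aq := partial_hom_poly q homA Az.
have [ringA AK A0] := homA.
have qz2 : z.2 * (map_poly iota q).[z.2] = 1.
  apply/eqP; rewrite -subr_eq0; apply/eqP/A0.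
  have := subringB ringA (subringM ringA Az Aq) (subring1 ringA).
  by rewrite -[0](subrr 1) -{1}qz.
eexists; first exact: Aq.
by rewrite mulrC [LHS]surjective_pairing /= qz qz2.
Qed.

Lemma horner_pair (Q : {poly (L * L)%type}) z :
  Q.[z] = ((map_poly fst Q).[z.1], (map_poly snd Q).[z.2]).
Proof.
by rewrite [LHS]surjective_pairing -(horner_map fst) -(horner_map snd).
Qed.

(** A maximal graph is total: take p monic of least degree over [A] whose first projection kills z,
    and z' a root of its second projection; division by p shows that adjoining (z, z') creates no
    pair (0, y) with y nonzero. *)
Lemma partial_hom_extend (A0 : set (L * L)) :
  partial_hom A0 ->
  exists sigma : galois_aut iota, forall z, A0 z -> z.2 = sigma z.1.
Proof.
move=> [ringA0 A0K A00].
have [|A [ringA A0A AB maxA]] := @maximal_subring (L * L)%type A0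
  [set z | z.1 = 0 /\ z.2 <> 0]%classic ringA0.
  by move=> [x y] Axy [/= xe]; rewrite xe in Axy; move/A00: Axy.
have homA : partial_hom A.
  split=> // [x|y Ay]; first exact/A0A/A0K.
  by apply: contrapT => y0; apply: (AB _ Ay).
have total z : exists z', A (z, z').
  (* With pairs as coefficients, a polynomial over the domain and its image are handled as one;
     being monic gives both projections the same degree. *)
  pose ann n := `[< exists p : {poly (L * L)%type}, [/\ p \is monic, forall i, A p`_i,
    root (map_poly fst p) z & size p = n] >].
  have exn : exists n, ann n.
    have [P [P0 Pz _]] := minimal_annihilator (closureK z).
    pose P' := (lead_coef P)^-1 *: P.
    pose Q := map_poly (fun x => (iota x, iota x)) P'.
    have coefQ i : Q`_i = (iota P'`_i, iota P'`_i) by rewrite coef_map_id0 // rmorph0.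
    exists (size Q); apply/asboolP; exists Q; split=> //.
    - rewrite monicE lead_coef_map_id0 ?rmorph0 // lead_coefZ mulVf ?lead_coef_eq0 //.
        by rewrite rmorph1.
      by rewrite rmorph1; exact: oner_neq0.
    - by move=> i; rewrite coefQ; case: homA.
    - have -> : map_poly fst Q = map_poly iota P' by apply/polyP => i; rewrite !coef_map coefQ.
      by rewrite map_polyZ /= rootZ // fmorph_eq0 invr_eq0 lead_coef_eq0.
  case: (ex_minnP exn) => n /asboolP[p [monp Ap pz <-]] minp.
  have sp : (1 < size p)%N.
    rewrite ltnNge; apply/negP => sp1.
    have p1 : p = 1.
      by move/monicP: monp; rewrite (size1_polyC sp1) lead_coefC => ->.
    by move: pz; rewrite p1 rmorph1 rootC oner_eq0.
  have [z' pz'] : exists z', root (map_poly snd p) z'.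
    apply/closed_rootP; rewrite size_map_poly_id0; last by rewrite (monicP monp) oner_neq0.
    by rewrite neq_ltn sp orbT.
  exists z'; apply: contrapT => /maxA[Q [AQ]]; rewrite horner_pair => -[/= Q1 Q2].
  (* Euclidean division by p: each step lowers the size of Q and keeps the values of its projections
     at z and z'. *)
  apply: Q2; elim: {Q}(size Q) {-2}Q (leqnn (size Q)) AQ Q1 => [|k IH] Q.
    by rewrite leqn0 size_poly_eq0 => /eqP -> _ _; rewrite rmorph0 horner0.
  move=> sQ AQ Q1; have [sQk|sQk] := leqP (size Q) k; first exact: IH.
  have {sQk} {}sQ : size Q = k.+1 by apply/eqP; rewrite eqn_leq sQ.
  pose c := Q`_k; have Ac : A c by exact: AQ.
  have c0 : c != 0 by rewrite /c -[k]/(k.+1.-1) -sQ -lead_coefE lead_coef_eq0 -size_poly_gt0 sQ.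
  have c10 : c.1 != 0.
    apply: contraNneq c0 => c1; move: Ac; rewrite [c]surjective_pairing c1 => Ac.
    by case: homA => _ _ /(_ _ Ac) ->.
  (* Since [L * L] is not a domain, Q is made monic by an inverse of its leading coefficient found
     in [A], and then compared with the minimal p. *)
  have spQ : (size p <= k.+1)%N.
    have [ci Aci cic] := partial_hom_unit homA Ac c10.
    have scQ : size (ci *: Q) = k.+1.
      apply/eqP; rewrite eqn_leq -{1}sQ size_scale_leq ltnNge; apply/negP => sle.
      have := nth_default 0 sle; rewrite coefZ -/c cic => /eqP.
      by rewrite oner_eq0.
    rewrite -scQ; apply: minp; apply/asboolP; exists (ci *: Q); split=> //.
    - by rewrite monicE lead_coefE scQ coefZ -/c cic.
    - by move=> i; rewrite coefZ; exact: subringM.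
    - by rewrite map_polyZ /root hornerZ Q1 mulr0.
  pose Q' := Q - c *: 'X^(k.+1 - size p) * p.
  have homQ' (f : {rmorphism (L * L)%type -> L}) x : root (map_poly f p) x ->
      (map_poly f Q').[x] = (map_poly f Q).[x].
    by move=> /rootP px; rewrite rmorphB rmorphM !hornerE px mulr0 subr0.
  rewrite -(homQ' snd) //; apply: IH.
  - apply/leq_sizeP => j; rewrite leq_eqVlt => /orP[/eqP <-|kj].
      rewrite coefB -scalerAl coefZ coefXnM ltnNge.
      have -> : (k.+1 - size p <= k)%N by lia.
      have -> : (k - (k.+1 - size p) = (size p).-1)%N by lia.
      by rewrite /= -lead_coefE (monicP monp) mulr1 subrr.
    rewrite coefB -scalerAl coefZ coefXnM; case: ltnP => _.
      by rewrite nth_default ?sQ // mulr0 subr0.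
    rewrite !nth_default ?sQ ?mulr0 ?subr0 //.
    by move: spQ kj; clear; move: (size p) => s; lia.
  - exact: (subring_poly ringA).
  - by rewrite (homQ' fst).
have uniqA x y y' : A (x, y) -> A (x, y') -> y = y'.
  move=> Ay Ay'; apply/eqP; rewrite -subr_eq0; apply/eqP.
  case: homA => _ _; apply; rewrite -[0](subrr x).
  exact: (subringB ringA Ay Ay').
have [s As] := choice total.
have sB : zmod_morphism s.
  by move=> x y; apply: uniqA (As _) (subringB ringA (As x) (As y)).
have sM : monoid_morphism s.
  split; first exact: uniqA (As 1) (subring1 ringA).
  by move=> x y; apply: uniqA (As _) (subringM ringA (As x) (As y)).
pose sigma : {rmorphism L -> L} := HB.pack s
  (GRing.isZmodMorphism.Build L L s sB) (GRing.isMonoidMorphism.Build L L s sM).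
have sK x : sigma (iota x) = iota x.
  by apply: uniqA (As _) _; case: homA.
(* [sigma] maps the finite set of roots of an annihilator of y injectively into itself, hence
   onto. *)
have surj y : exists x, sigma x = y.
  have [P [P0 Py _]] := minimal_annihilator (closureK y).
  have [r Pr] := closed_field_poly_normal (map_poly iota P).
  have memr x : (x \in undup r) = root (map_poly iota P) x.
    rewrite mem_undup Pr rootZ ?root_prod_XsubC //.
    by rewrite lead_coef_eq0 map_poly_eq0.
  have sub : {subset map sigma (undup r) <= undup r}.
    move=> _ /mapP[x + ->]; rewrite !memr => Px.
    have -> : map_poly iota P = map_poly sigma (map_poly iota P).
      by apply/polyP => i; rewrite !coef_map; exact/esym/sK.
    by rewrite fmorph_root.
  have us : uniq (map sigma (undup r)).
    by rewrite map_inj_uniq ?undup_uniq //; exact: fmorph_inj.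
  have [|_ eqr] := uniq_min_size us sub; first by rewrite size_map.
  have : y \in map sigma (undup r) by rewrite eqr memr.
  by case/mapP => x _ ->; exists x.
have [s' sK'] := choice surj.
have bij : bijective sigma.
  by exists s' => // x; apply: (fmorph_inj sigma); rewrite sK'.
exists (GaloisAut bij sK) => -[x y] /A0A Axy.
exact: uniqA Axy (As x).
Qed.

(** The pairs (q(t), q(t')) form the graph of a map K[t] -> K[t'], well defined because any q
    vanishing at t is a multiple of [P]. *)
Lemma minimal_conjugate (P : {poly K}) t t' :
  (forall q, root (map_poly iota q) t -> P %| q) -> root (map_poly iota P) t' ->
  exists sigma : galois_aut iota, sigma t = t'.
Proof.
move=> minP Pt'.
have [|sigma ext] := @partial_hom_extend
  [set z | exists q, z = ((map_poly iota q).[t], (map_poly iota q).[t'])]%classic.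
  split=> [|x|y [q [/esym qt ->]]].
  - split.
    + by exists 1; rewrite rmorph1 !hornerC.
    + by move=> _ _ [p ->] [q ->]; exists (p - q); rewrite rmorphB !hornerD !hornerN.
    + by move=> _ _ [p ->] [q ->]; exists (p * q); rewrite rmorphM !hornerM.
  - by exists x%:P; rewrite map_polyC !hornerC.
  - have /minP/dvdpP[r ->] : root (map_poly iota q) t by exact/rootP.
    by rewrite rmorphM hornerM (rootP Pt') mulr0.
exists sigma; apply/esym/(ext (t, t')); exists 'X.
by rewrite map_polyX !hornerX.
Qed.

Lemma galois_orbit (t : L) : [pchar K] =i pred0 ->
  exists (P : {poly K}) (r : seq L), [/\ P != 0, root (map_poly iota P) t, uniq r,
    size r = (size P).-1 &
    forall x, x \in r -> exists sigma : galois_aut iota, sigma t = x].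
Proof.
move=> charK; have [P [P0 Pt minP]] := minimal_annihilator (closureK t).
have [r Pr] := closed_field_poly_normal (map_poly iota P).
have lP0 : lead_coef (map_poly iota P) != 0 by rewrite lead_coef_eq0 map_poly_eq0.
exists P, r; split=> //.
- rewrite -separable_prod_XsubC; have := minimal_separable charK P0 Pt minP.
  by rewrite -(separable_map iota) Pr (eqp_separable (eqp_scale _ lP0)).
- by rewrite -(size_map_poly iota) Pr size_scale // size_prod_XsubC.
- move=> x xr; apply: (minimal_conjugate minP).
  by rewrite Pr rootZ // root_prod_XsubC.
Qed.

(* Compactness of the Galois group, stated with two automorphisms so that no
   composition or inverse of automorphisms is needed. *)
Lemma conjugate_sequence (a b : nat -> L) :
  (forall n, exists sigma tau : galois_aut iota,
    forall i, (i <= n)%N -> sigma (a i) = tau (b i)) ->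
  exists sigma : galois_aut iota, forall i, sigma (a i) = b i.
Proof.
move=> ab.
(* The pairs respected, from some level n on, by every tau^-1 sigma that carries a to b up to n. As
   each level admits such sigma and tau, (0, y) forces y = 0. *)
pose A0 : set (L * L) := [set z | exists n, forall sigma tau : galois_aut iota,
  (forall i, (i <= n)%N -> sigma (a i) = tau (b i)) -> tau z.2 = sigma z.1]%classic.
have [|sigma ext] := @partial_hom_extend A0.
  split=> [|x|y [n /= ny]].
  - split.
    + by exists 0%N => sigma tau _ /=; rewrite !rmorph1.
    + move=> x y [n nx] [m my]; exists (maxn n m) => sigma tau nm /=; rewrite !rmorphB.
      by rewrite (nx sigma tau) ?(my sigma tau) // => i im; apply: nm; rewrite leq_max im ?orbT.
    + move=> x y [n nx] [m my]; exists (maxn n m) => sigma tau nm /=; rewrite !rmorphM.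
      by rewrite (nx sigma tau) ?(my sigma tau) // => i im; apply: nm; rewrite leq_max im ?orbT.
  - by exists 0%N => sigma tau _; rewrite !galois_fix.
  - have [sigma [tau /ny]] := ab n; rewrite rmorph0 => /eqP.
    by rewrite fmorph_eq0 => /eqP.
by exists sigma => i; apply/esym/(ext (a i, b i)); exists i => rho tau /(_ i (leqnn i)) /=.
Qed.

End GaloisExtension.

(** * Finitely many representatives by pigeonhole *)

(** Otherwise the range of a finite sequence in [A] never represents all of [A], so elements
    unrelated to the earlier ones can be added until N + 1 of them contradict the hypothesis. *)
Lemma finite_representatives (X : Type) (A : set X) (E : X -> X -> Prop) (N : nat) :
  (forall x : nat -> X, (forall i, (i <= N)%N -> A (x i)) ->
     exists i j, [/\ (i < j)%N, (j <= N)%N & E (x i) (x j)]) ->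
  exists S : set X, [/\ finite_set S, (S `<=` A)%classic &
    forall a, A a -> exists2 s, S s & E s a].
Proof.
move=> noN; apply: contrapT => noS.
suff [x [Ax Ex]] : exists x : nat -> X, (forall i, (i < N.+1)%N -> A (x i)) /\
    forall i j, (i < j)%N -> (j < N.+1)%N -> ~ E (x i) (x j).
  by have [i [j [ij jN]]] := noN x Ax; exact: Ex.
elim: N.+1 => [|k [x [Ax Ex]]].
  (* Even the empty sequence is encoded by a function on all of nat, so [X] must be inhabited here;
     if it is empty, the empty set of representatives works. *)
  have [[x _]|e] := pselect (exists x : X, True); first by exists (fun=> x).
  exfalso; apply: noS; exists set0; split=> // a _.
  by exfalso; apply: e; exists a.
have [a Aa Ea] : exists2 a, A a & forall i, (i < k)%N -> ~ E (x i) a.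
  apply: contrapT => noa; apply: noS; exists (x @` `I_k)%classic; split.
  - exact/finite_image/finite_II.
  - by move=> _ [i /= ik <-]; exact: Ax.
  - move=> a Aa; apply: contrapT => nos; apply: noa; exists a => // i ik Eia.
    by apply: nos; exists (x i) => //; exists i.
exists (fun i => if i == k then a else x i); split=> [i|i j ij].
  by rewrite ltnS leq_eqVlt; case: eqP => //= _ ik; exact: Ax.
rewrite ltnS leq_eqVlt; case: eqP => [jk _|_ /= jk].
  by rewrite jk in ij; rewrite (ltn_eqF ij); exact: Ea.
by rewrite (ltn_eqF (ltn_trans ij jk)); exact: Ex.
Qed.

(** * Backward paths: count, values and Galois orbits *)

Section Paths.

Variables (K : fieldType) (v : discrete_valuation K).
Variables (L : closedFieldType) (iota : {rmorphism K -> L}).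
Variables (f g : {poly K}) (alpha : K).

Lemma galois_act_path (sigma : galois_aut iota) a :
  backward_paths iota f g alpha a -> backward_paths iota f g alpha (galois_act sigma a).
Proof.
move=> [a0 edge]; split=> [|n]; first by rewrite /galois_act a0 galois_fix.
have fixp (p : {poly K}) : map_poly iota p = map_poly sigma (map_poly iota p).
  by apply/polyP => i; rewrite !coef_map; exact/esym/galois_fix.
rewrite /corr_edge /galois_act (fixp f) (fixp g) !horner_map.
by congr (sigma _); exact: edge.
Qed.

(** Each backward step solves f(x) = g(y); listing the solutions with multiplicity makes all lists
    have length deg f, so that the lengths multiply. *)
Lemma path_cover n : (1 < size f)%N ->
  exists T : seq (seq L), (size T <= deg f ^ n)%N /\
    forall a, backward_paths iota f g alpha a -> mkseq a n.+1 \in T.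
Proof.
move=> sf; elim: n => [|n [T [sT aT]]].
  exists [:: [:: iota alpha]]; split=> // a [a0 _].
  by rewrite /mkseq /= a0 inE.
have /choice[r fr] (y : L) : exists r : seq L, size r = deg f /\
    forall x, (map_poly iota g).[y] = (map_poly iota f).[x] -> x \in r.
  pose p := map_poly iota f - ((map_poly iota g).[y])%:P.
  have sp : size p = size f.
    rewrite size_polyDl size_map_poly // size_polyN.
    exact: leq_ltn_trans (size_polyC_leq1 _) sf.
  have [r pr] := closed_field_poly_normal p.
  have lp0 : lead_coef p != 0 by rewrite lead_coef_eq0 -size_poly_gt0 sp ltnW.
  exists r; split; first by rewrite /deg -sp pr size_scale // size_prod_XsubC.
  move=> x yx; rewrite -root_prod_XsubC -(rootZ _ _ lp0) -pr.
  by rewrite /root /p hornerD hornerN hornerC yx subrr.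
exists [seq rcons s x | s <- T, x <- r (last 0 s)]; split.
  rewrite size_allpairs_dep.
  have -> : [seq size (r (last 0 x)) | x <- T] = nseq (size T) (deg f).
    by elim: (T) => //= s T' ->; rewrite (fr _).1.
  by rewrite sumn_nseq expnS leq_mul2l sT orbT.
move=> a pa; rewrite mkseqS; apply: allpairs_f_dep; first exact: aT.
rewrite mkseqS last_rcons; apply: (fr _).2; case: pa => _; exact.
Qed.

Hypothesis closureK : algebraic_closure iota.
Hypothesis charK : [pchar K] =i pred0.
Hypothesis f_ring : f \is a polyOver (valuation_ring v).
Hypothesis g_ring : g \is a polyOver (valuation_ring v).
Hypothesis f_unit : lead_coef f \in valuation_ring_unit v.
Hypothesis g_unit : lead_coef g \in valuation_ring_unit v.
Hypothesis f_gt1 : (1 < size f)%N.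
Hypothesis g_gt1 : (1 < size g)%N.
Hypothesis coprime_deg : coprime (deg f) (deg g).
Hypothesis alpha_nonint : alpha \notin valuation_ring v.

(** Along the edges, d^(n+1) v(a_(n+1)) = d^n e v(a_n) = e^(n+1) v(alpha); non-integrality is
    carried along because the next edge requires it. *)
Lemma path_value (O : set L) a n :
  is_valuation_ring O -> (forall x, O (iota x) <-> x \in valuation_ring v) ->
  backward_paths iota f g alpha a ->
  ~ O (a n) /\ same_value O (a n ^+ (deg f ^ n)) (iota alpha ^+ (deg g ^ n)).
Proof.
move=> valO Ov [a0 edge].
have Opoly (p : {poly K}) : p \is a polyOver (valuation_ring v) ->
    forall i, O (map_poly iota p)`_i.
  move=> /allP pO i; rewrite coef_map; apply/Ov.
  have [ip|ip] := ltnP i (size p); first exact/pO/mem_nth.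
  by rewrite nth_default // inE eqxx.
have Olead (p : {poly K}) : lead_coef p \in valuation_ring_unit v ->
    O (lead_coef (map_poly iota p))^-1.
  by rewrite inE => /and3P[_ _ pO]; rewrite lead_coef_map -fmorphV; exact/Ov.
elim: n => [|n [nOn IH]].
  rewrite a0 !expn0 !expr1; have nO : ~ O (iota alpha) by move=> /Ov; apply/negP.
  split=> //; apply: same_value_refl => //.
  apply/eqP => z; apply: nO; rewrite z.
  exact: subring0 (vring_subring valO).
have f0 : map_poly iota f != 0 by rewrite -size_poly_gt0 size_map_poly ltnW.
have g1 : (1 < size (map_poly iota g))%N by rewrite size_map_poly.
have [nO edgeO] := same_value_edge valO (Opoly f f_ring) f0 (Olead f f_unit)
  (Opoly g g_ring) g1 (Olead g g_unit) nOn (edge n).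
split=> //; rewrite !expnS exprM [(deg g * _)%N]mulnC [iota alpha ^+ _]exprM.
apply: (@same_value_trans L O valO ((a n ^+ deg g) ^+ (deg f ^ n))).
  by move: edgeO; rewrite !size_map_poly; apply: same_valueX.
by rewrite -exprM mulnC exprM; apply: same_valueX.
Qed.

(** Truncations are already told apart by their last term, so there are at least as many as
    conjugates of [a n], whose number is its degree over K. *)
Lemma truncated_orbit a n : backward_paths iota f g alpha a ->
  exists l : seq (seq L), [/\ uniq l, (deg f ^ n <= size l * `|v alpha|)%N &
    forall s, s \in l -> exists sigma : galois_aut iota,
      s = mkseq (galois_act sigma a) n.+1].
Proof.
move=> pa; have [O [valO Ov]] := valuation_ring_over v iota.
have [_ va] := path_value n valO Ov pa.
have [P [r [P0 Pa ur sr conj]]] := galois_orbit closureK (a n) charK.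
have /choice[h hP] x : exists s : seq L, x \in r ->
    (exists sigma : galois_aut iota, s = mkseq (galois_act sigma a) n.+1) /\ last 0 s = x.
  have [xr|_] := boolP (x \in r); last by exists [::].
  have [sigma sx] := conj x xr.
  exists (mkseq (galois_act sigma a) n.+1) => _; split; first by exists sigma.
  by rewrite mkseqS last_rcons.
exists (map h r); split.
- rewrite map_inj_in_uniq // => x y xr yr hxy.
  by rewrite -(hP x xr).2 hxy (hP y yr).2.
- have al0 : alpha != 0 by apply: contraNneq alpha_nonint => ->; rewrite inE eqxx.
  rewrite size_map sr; apply: (annihilator_size valO Ov P0 Pa al0 _ _ _ va).
  + by move: alpha_nonint; rewrite valuation_ringP // -ltNge lt_neqAle => /andP[].
  + by rewrite expn_gt0 /deg -ltnS prednK ?f_gt1 // ltnW.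
  + by rewrite coprimeXl // coprimeXr.
- by move=> _ /mapP[x xr ->]; case: (hP x xr).
Qed.

(** With m = |v(alpha)|, m + 1 pairwise non-conjugate paths would have disjoint orbits at some level
    n, together of at least (m + 1) d^n / m elements, whereas there are at most d^n truncated
    paths. *)
Lemma conjugate_paths (x : nat -> nat -> L) :
  (forall i, (i <= `|v alpha|)%N -> backward_paths iota f g alpha (x i)) ->
  exists i j, [/\ (i < j)%N, (j <= `|v alpha|)%N &
    exists sigma : galois_aut iota, forall n, sigma (x i n) = x j n].
Proof.
set m := absz _ => px; apply: contrapT => noconj.
(* By [conjugate_sequence], two non-conjugate paths have a level at which their truncations share no
   conjugate; the guards make [N] total, with arbitrary values on irrelevant pairs. *)
have /choice[N NP] (ij : nat * nat) : exists N, (ij.1 < ij.2)%N -> (ij.2 <= m)%N ->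
    forall sigma tau : galois_aut iota,
    ~ (forall n, (n <= N)%N -> sigma (x ij.1 n) = tau (x ij.2 n)).
  apply: contrapT => noN.
  have [ltij jm] : (ij.1 < ij.2)%N /\ (ij.2 <= m)%N.
    split; apply: contrapT => h; apply: noN; exists 0%N => h1 h2; by exfalso; apply: h.
  apply: noconj; exists ij.1, ij.2; split=> //.
  apply: (conjugate_sequence closureK) => n; apply: contrapT => nosig.
  by apply: noN; exists n => _ _ sigma tau hs; apply: nosig; exists sigma, tau.
pose n := (\max_(i < m.+1) \max_(j < m.+1) N (i : nat, j : nat))%N.
have Nn i j : (i <= m)%N -> (j <= m)%N -> (N (i, j) <= n)%N.
  rewrite -ltnS => im; rewrite -ltnS => jm.
  apply: leq_trans (leq_bigmax (Ordinal im)).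
  exact: (leq_bigmax (F := fun j : 'I_m.+1 => N (i, j : nat)) (Ordinal jm)).
have [T [sT xT]] := path_cover n f_gt1.
suff [l [ul sl lP]] : exists l : seq (seq L), [/\ uniq l,
    (m.+1 * deg f ^ n <= size l * m)%N &
    forall s, s \in l -> exists i (sigma : galois_aut iota), (i < m.+1)%N /\
      s = mkseq (galois_act sigma (x i)) n.+1].
  have : (size l <= size T)%N.
    apply: uniq_leq_size => // s /lP[i [sigma [im ->]]].
    by apply: xT; apply: galois_act_path; exact: px.
  move=> /leq_trans/(_ sT) lef; have := leq_trans sl (leq_mul lef (leqnn m)).
  rewrite mulnC leq_mul2l ltnn orbF expn_eq0 => /andP[+ _].
  by rewrite /deg -leqn0 leqNgt -ltnS prednK ?f_gt1 // ltnW.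
elim: {-2}m.+1 (leqnn m.+1) => [|k IH] km; first by exists [::].
have [l [ul sl lP]] := IH (ltnW km).
have [l' [ul' sl' lP']] := truncated_orbit n (px k km).
exists (l ++ l'); split.
- rewrite cat_uniq ul ul' andbT; apply/hasPn => s /lP'[tau st]; apply/negP.
  move=> /lP[i [sigma [ik se]]].
  apply: (NP (i, k) ik km sigma tau) => p pN /=.
  have pn : (p < n.+1)%N by apply: leq_trans pN (Nn i k _ km); exact: leq_trans (ltnW ik) km.
  by have := congr1 (nth 0 ^~ p) se; rewrite st !nth_mkseq.
- by rewrite size_cat mulnDl mulSn addnC; apply: leq_add.
- move=> s; rewrite mem_cat => /orP[/lP[i [sigma [ik ->]]]|/lP'[sigma ->]].
    by exists i, sigma; split=> //; exact: ltnW.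
  by exists k, sigma.
Qed.

End Paths.

Theorem theorem1 (K : fieldType) (v : discrete_valuation K)
    (Kbar : closedFieldType) (iota : {rmorphism K -> Kbar})
    (f g : {poly K}) (alpha : K)
    (charK : [pchar K] =i pred0)
    (closureK : algebraic_closure iota)
    (deg_g_ge1 : (1 <= deg g)%N)
    (fg_polarized : polarized f g)
    (fg_good : good_reduction v f g)
    (deg_f_unit : (deg f)%:R \in valuation_ring_unit v)
    (deg_g_unit : (deg g)%:R \in valuation_ring_unit v)
    (deg_coprime : gcdn (deg f) (deg g) = 1%N)
    (alpha_nonintegral : alpha \notin valuation_ring v) :
  nearly_transitive (@galois_act K Kbar iota) (backward_paths iota f g alpha).
Proof.
have [f_ring g_ring f_unit g_unit] := fg_good.
have size_gt1 (p : {poly K}) : (1 <= deg p)%N -> (1 < size p)%N by rewrite /deg -ltnS; case: size.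
have g_gt1 := size_gt1 _ deg_g_ge1.
have f_gt1 := size_gt1 _ (ltnW (leq_ltn_trans deg_g_ge1 fg_polarized)).
have cop : coprime (deg f) (deg g) by rewrite /coprime deg_coprime.
have [S [finS SA repS]] := @finite_representatives _ _
  (fun a b => exists sigma : galois_aut iota, forall n, sigma (a n) = b n) _
  (conjugate_paths closureK charK f_ring g_ring f_unit g_unit f_gt1 g_gt1 cop alpha_nonintegral).
exists S => //; apply/seteqP; split=> [a /repS[s Ss [sigma sa]]|a [s Ss [sigma ->]]].
  by exists s => //; exists sigma; apply/funext => n; rewrite /galois_act sa.
exact/galois_act_path/SA.
Qed.
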